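(* Let $\mathfrak{a}, \mathfrak{b}, \mathfrak{c}, \mathfrak{d}$ be small $k$-linear categories endowed with topologies $\mathcal{T}_{\mathfrak{a}}, \mathcal{T}_{\mathfrak{b}}, \mathcal{T}_{\mathfrak{c}}, \mathcal{T}_{\mathfrak{d}}$ respectively, and let $\phi : \mathfrak{a} \to \mathfrak{c}$ and $\psi : \mathfrak{b} \to \mathfrak{d}$ be $k$-linear functors. Consider $\phi : (\mathfrak{a}, \mathcal{T}_{\mathfrak{a}}) \to (\mathfrak{c}, \mathcal{T}_{\mathfrak{c}})$, $\psi : (\mathfrak{b}, \mathcal{T}_{\mathfrak{b}}) \to (\mathfrak{d}, \mathcal{T}_{\mathfrak{d}})$ and $\phi \otimes \psi : (\mathfrak{a} \otimes \mathfrak{b}, \mathcal{T}_{\mathfrak{a}} \boxtimes \mathcal{T}_{\mathfrak{b}}) \to (\mathfrak{c} \otimes \mathfrak{d}, \mathcal{T}_{\mathfrak{c}} \boxtimes \mathcal{T}_{\mathfrak{d}})$. (i) If $\phi$ and $\psi$ both satisfy (G), then so does $\phi \otimes \psi$. (ii) If $\phi$ and $\psi$ both satisfy (F), then so does $\phi \otimes \psi$. (iii) If $\phi$ and $\psi$ both satisfy (F) and (FF), then so does $\phi \otimes \psi$. (iv) If $\phi$ and $\psi$ both satisfy (LC), then so does $\phi \otimes \psi$.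
   Context: $k$ is a commutative ring. The tensor product $\mathfrak{a} \otimes \mathfrak{b}$ of $k$-linear categories has objects the pairs $(A,B)$ and $(\mathfrak{a} \otimes \mathfrak{b})((A',B'),(A,B)) = \mathfrak{a}(A',A) \otimes_k \mathfrak{b}(B',B)$; $\phi \otimes \psi$ is the induced functor. A sieve on $A \in \mathfrak{a}$ is a submodule $R \subseteq \mathfrak{a}(-,A)$ (of the $k$-linear functor $\mathfrak{a}(-,A) : \mathfrak{a}^{\mathrm{op}} \to \mathrm{Mod}(k)$); for $f : A' \to A$, $f^{-1}R = \{g \mid fg \in R\}$. A (linear) topology $\mathcal{T}$ on $\mathfrak{a}$ specifies for every $A$ a collection $\mathcal{T}(A)$ of (covering) sieves on $A$ such that: $\mathfrak{a}(-,A) \in \mathcal{T}(A)$ (identity); $R \in \mathcal{T}(A)$ and $f : A' \to A$ imply $f^{-1}R \in \mathcal{T}(A')$ (pullback); if $R \in \mathcal{T}(A)$ and $S$ is a sieve on $A$ with $f^{-1}S \in \mathcal{T}(A')$ for all $f \in R(A')$, then $S \in \mathcal{T}(A)$ (glueing). A family of morphisms $(A_i \to A)_i$ is covering if the sieve it generates is in $\mathcal{T}(A)$. For sieves $R$ on $A$ and $S$ on $B$, $R \boxtimes S$ is the image of $R \otimes S \to (\mathfrak{a} \otimes \mathfrak{b})(-,(A,B))$, where $(R\otimes S)(A',B') = R(A')\otimes_k S(B')$. $\mathcal{T}_{\mathfrak{a}} \boxtimes \mathcal{T}_{\mathfrak{b}}$ is the smallest topology on $\mathfrak{a} \otimes \mathfrak{b}$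 containing all sieves $R \boxtimes \mathfrak{b}(-,B)$ with $R \in \mathcal{T}_{\mathfrak{a}}(A)$ and all sieves $\mathfrak{a}(-,A) \boxtimes S$ with $S \in \mathcal{T}_{\mathfrak{b}}(B)$ ($A \in \mathfrak{a}$, $B \in \mathfrak{b}$). For a $k$-linear functor $\phi : (\mathfrak{a}, \mathcal{T}_{\mathfrak{a}}) \to (\mathfrak{c}, \mathcal{T}_{\mathfrak{c}})$: (G): for every $C \in \mathfrak{c}$ there is a covering family $(\phi(A_i) \to C)_i$ for $\mathcal{T}_{\mathfrak{c}}$. (F): for every $c : \phi(A) \to \phi(A')$ in $\mathfrak{c}$ there exist a covering family $a_i : A_i \to A$ for $\mathcal{T}_{\mathfrak{a}}$ and morphisms $f_i : A_i \to A'$ with $c\,\phi(a_i) = \phi(f_i)$ for all $i$. (FF): for every $a : A \to A'$ in $\mathfrak{a}$ with $\phi(a) = 0$ there exists a covering family $a_i : A_i \to A$ for $\mathcal{T}_{\mathfrak{a}}$ with $a a_i = 0$ for all $i$. (LC): $\phi$ satisfies (G), (F) and (FF), and $\mathcal{T}_{\mathfrak{a}} = \phi^{-1}\mathcal{T}_{\mathfrak{c}}$, where a sieve $R$ on $A$ is in $\phi^{-1}\mathcal{T}_{\mathfrak{c}}(A)$ iff the sieve $\phi R$ on $\phi(A)$ generated by all $\phi(f)$, $f \in R$, is in $\mathcal{T}_{\mathfrak{c}}(\phi(A))$. *)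

(* Defs.v *)
From HB Require Import structures.
From mathcomp Require Import all_boot all_order all_algebra.
From mathcomp Require Import generic_quotient boolp classical_sets.

Set Implicit Arguments.
Unset Strict Implicit.
Unset Printing Implicit Defensive.

Import GRing.Theory.
Local Open Scope ring_scope.
Local Open Scope quotient_scope.

(** A list [:: (u1, v1); ...; (un, vn)] stands for u1 (x) v1 + ... + un (x) vn;
    [tensor_eq] is the congruence generated by the commutativity of the sum and
    the bilinearity relations.  The rule [teq0l] makes the quotient a group
    rather than a mere monoid. *)

Section Tensor.
Variable k : comPzRingType.

Inductive tensor_eq (U V : lmodType k) : seq (U * V) -> seq (U * V) -> Prop :=
| teq_refl s : tensor_eq s s
| teq_sym s t : tensor_eq s t -> tensor_eq t s
| teq_trans s t r : tensor_eq s t -> tensor_eq t r -> tensor_eq s r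
| teq_cat s s' t t' : tensor_eq s s' -> tensor_eq t t' ->
    tensor_eq (s ++ t) (s' ++ t')
| teq_catC s t : tensor_eq (s ++ t) (t ++ s)
| teq0l v : tensor_eq [:: (0, v)] [::]
| teqDl u u' v : tensor_eq [:: (u + u', v)] [:: (u, v); (u', v)]
| teqDr u v v' : tensor_eq [:: (u, v + v')] [:: (u, v); (u, v')]
| teqZ a u v : tensor_eq [:: (a *: u, v)] [:: (u, a *: v)].

Section Quotient.
Variables U V : lmodType k.

Definition tensor_eqb : rel (seq (U * V)) := fun s t => `[< tensor_eq s t >].

Lemma tensor_eqb_refl : reflexive tensor_eqb.
Proof. by move=> s; apply/asboolP; exact: teq_refl. Qed.

Lemma tensor_eqb_sym : symmetric tensor_eqb.
Proof. by move=> s t; apply/asboolP/asboolP; exact: teq_sym. Qed.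

Lemma tensor_eqb_trans : transitive tensor_eqb.
Proof.
move=> t s r /asboolP st /asboolP tr; apply/asboolP; exact: teq_trans st tr.
Qed.

Canonical tensor_equiv :=
  EquivRel tensor_eqb tensor_eqb_refl tensor_eqb_sym tensor_eqb_trans.

Definition tensor : Type := {eq_quot tensor_equiv}.
HB.instance Definition _ := Choice.on tensor.
HB.instance Definition _ := EqQuotient.on tensor.

Definition tpi (s : seq (U * V)) : tensor := \pi_tensor s.

Lemma tpiP s t : tpi s = tpi t <-> tensor_eq s t.
Proof.
split=> [/eqP|st]; first by rewrite /tpi eqmodE => /asboolP.
by apply/eqP; rewrite /tpi eqmodE; apply/asboolP.
Qed.

Lemma tpi_repr t : tpi (repr t) = t.
Proof. exact: reprK. Qed.

Definition tzero : tensor := tpi [::].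
Definition tadd (s t : tensor) : tensor := tpi (repr s ++ repr t).

Lemma taddE s t : tadd (tpi s) (tpi t) = tpi (s ++ t).
Proof. by apply/tpiP; apply: teq_cat; apply/tpiP; exact: tpi_repr. Qed.

Definition pscale (a : k) (p : U * V) : U * V := (a *: p.1, p.2).

Lemma teq_map a s t :
  tensor_eq s t -> tensor_eq (map (pscale a) s) (map (pscale a) t).
Proof.
elim=> {s t} [s|s t _ |s t r _ + _|s s' t t' _ + _|s t|v|u u' v|u v v'|b u v].
- exact: teq_refl.
- exact: teq_sym.
- exact: teq_trans.
- by rewrite !map_cat; exact: teq_cat.
- by rewrite !map_cat; exact: teq_catC.
- by rewrite /pscale /= scaler0; exact: teq0l.
- by rewrite /pscale /= scalerDr; exact: teqDl.
- exact: teqDr.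
- by rewrite /pscale /= scalerA mulrC -scalerA; exact: teqZ.
Qed.

Definition tscale (a : k) (s : tensor) : tensor :=
  tpi (map (pscale a) (repr s)).

Lemma tscaleE a s : tscale a (tpi s) = tpi (map (pscale a) s).
Proof. by apply/tpiP/teq_map/tpiP; exact: tpi_repr. Qed.

Lemma taddA : associative tadd.
Proof.
move=> x y z; rewrite -(tpi_repr x) -(tpi_repr y) -(tpi_repr z).
by rewrite !taddE catA.
Qed.

Lemma taddC : commutative tadd.
Proof.
move=> x y; rewrite -(tpi_repr x) -(tpi_repr y) !taddE.
by apply/tpiP; exact: teq_catC.
Qed.

Lemma tadd0 : left_id tzero tadd.
Proof. by move=> x; rewrite -(tpi_repr x) taddE. Qed.

Lemma tscaleDr a : {morph tscale a : s t / tadd s t}.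
Proof.
move=> x y; rewrite -(tpi_repr x) -(tpi_repr y).
by rewrite !(taddE, tscaleE) map_cat.
Qed.

Lemma tscaleA a b s : tscale a (tscale b s) = tscale (a * b) s.
Proof.
rewrite -(tpi_repr s) !tscaleE -map_comp; congr tpi.
by apply: eq_map => p; rewrite /pscale /= scalerA.
Qed.

Lemma tscale1 : left_id 1 tscale.
Proof.
move=> s; rewrite -(tpi_repr s) tscaleE; congr tpi.
by rewrite -[RHS]map_id; apply: eq_map => -[u v]; rewrite /pscale /= scale1r.
Qed.

Lemma tscale_nil a : tscale a tzero = tzero.
Proof. by rewrite tscaleE. Qed.

Lemma tscaleDl s a b : tscale (a + b) s = tadd (tscale a s) (tscale b s).
Proof.
rewrite -(tpi_repr s) !tscaleE taddE.
elim: (repr s) => [//|[u v] r IHr]; rewrite /= {1}/pscale /=.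
rewrite -cat1s -[(a *: u, v) :: _]cat1s -[(b *: u, v) :: _]cat1s -!taddE.
rewrite IHr -taddE.
have -> : tpi [:: ((a + b) *: u, v)] =
          tadd (tpi [:: (a *: u, v)]) (tpi [:: (b *: u, v)]).
  by rewrite taddE scalerDl; apply/tpiP; exact: teqDl.
by rewrite -!taddA; congr tadd; rewrite !taddA; congr tadd; rewrite taddC.
Qed.

Lemma tscale0 s : tscale 0 s = tzero.
Proof.
rewrite -(tpi_repr s) tscaleE.
elim: (repr s) => [//|[u v] r IHr]; rewrite /= {1}/pscale /=.
rewrite -cat1s -taddE IHr scale0r taddC tadd0.
by apply/tpiP; exact: teq0l.
Qed.

Definition topp (s : tensor) : tensor := tscale (- 1) s.

Lemma taddN : left_inverse tzero topp tadd.
Proof.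
by move=> s; rewrite /topp -{2}(tscale1 s) -tscaleDl addNr tscale0.
Qed.

HB.instance Definition _ := GRing.isZmodule.Build tensor
  taddA taddC tadd0 taddN.
HB.instance Definition _ := GRing.Zmodule_isLmodule.Build k tensor
  tscaleA tscale1 tscaleDr tscaleDl.

Definition tens (u : U) (v : V) : tensor := tpi [:: (u, v)].

Lemma tens_linearl v : linear (tens^~ v).
Proof.
move=> a u u'; rewrite /tens.
have -> : tpi [:: (a *: u + u', v)] = tpi ([:: (a *: u, v)] ++ [:: (u', v)]).
  by apply/tpiP; exact: teqDl.
by rewrite -taddE; congr (_ + _); rewrite -[RHS]/(tscale _ _) tscaleE.
Qed.

Lemma tens_linearr u : linear (tens u).
Proof.
move=> a v v'; rewrite /tens.
have -> : tpi [:: (u, a *: v + v')] = tpi ([:: (u, a *: v)] ++ [:: (u, v')]).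
  by apply/tpiP; exact: teqDr.
rewrite -taddE; congr (_ + _); rewrite -[RHS]/(tscale _ _) tscaleE /=.
by apply/esym/tpiP; exact: teqZ.
Qed.

Lemma tpi_sum s : tpi s = \sum_(p <- s) tens p.1 p.2.
Proof.
elim: s => [|[u v] s IHs]; first by rewrite big_nil.
by rewrite big_cons -IHs -cat1s -taddE.
Qed.

Lemma tens_repr t : t = \sum_(p <- repr t) tens p.1 p.2.
Proof. by rewrite -tpi_sum tpi_repr. Qed.

Lemma tensor_ind (P : tensor -> Prop) :
  P 0 -> (forall s t, P s -> P t -> P (s + t)) ->
  (forall u v, P (tens u v)) -> forall t, P t.
Proof.
move=> P0 PD Pt t; rewrite (tens_repr t).
by elim/big_ind: _.
Qed.

End Quotient.

Section Lift.
Variables (U V W : lmodType k) (b : U -> V -> W).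

Definition tlift (t : tensor U V) : W := \sum_(p <- repr t) b p.1 p.2.

Hypothesis bl : forall v, linear (b^~ v).
Hypothesis br : forall u, linear (b u).

Let bDl u u' v : b (u + u') v = b u v + b u' v.
Proof. by have := bl v 1 u u'; rewrite !scale1r. Qed.
Let bDr u v v' : b u (v + v') = b u v + b u v'.
Proof. by have := br u 1 v v'; rewrite !scale1r. Qed.
Let b0l v : b 0 v = 0.
Proof. by apply: (@addrI _ (b 0 v)); rewrite -bDl !addr0. Qed.
Let b0r u : b u 0 = 0.
Proof. by apply: (@addrI _ (b u 0)); rewrite -bDr !addr0. Qed.
Let bZl a u v : b (a *: u) v = a *: b u v.
Proof. by have := bl v a u 0; rewrite b0l !addr0. Qed.
Let bZr a u v : b u (a *: v) = a *: b u v.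
Proof. by have := br u a v 0; rewrite b0r !addr0. Qed.

Lemma tlift_tpi s : tlift (tpi s) = \sum_(p <- s) b p.1 p.2.
Proof.
rewrite /tlift.
have /tpiP : tpi (repr (tpi s)) = tpi s by exact: tpi_repr.
move: (repr _) => s0.
elim=> {s s0} [s|s t _ |s t r _ -> _|s s' t t' _ + _|s t|v|u u' v|u v v'|a u v] //.
- by rewrite !big_cat /= => -> ->.
- by rewrite !big_cat /= addrC.
- by rewrite big_seq1 big_nil /= b0l.
- by rewrite big_seq1 !big_cons big_nil /= bDl addr0.
- by rewrite big_seq1 !big_cons big_nil /= bDr addr0.
- by rewrite !big_seq1 /= bZl bZr.
Qed.

Lemma tlift_tens u v : tlift (tens u v) = b u v.
Proof. by rewrite tlift_tpi big_seq1. Qed.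

Lemma tlift_linear : linear tlift.
Proof.
move=> a s t; rewrite -(tpi_repr s) -(tpi_repr t).
rewrite -[a *: _]/(tscale _ _) tscaleE -[_ + _]/(tadd _ _) taddE !tlift_tpi.
rewrite big_cat big_map scaler_sumr; congr (_ + _).
by apply: eq_bigr => p _; rewrite bZl.
Qed.

End Lift.

Lemma linear_tensor_ext (U V W : lmodType k) (f g : tensor U V -> W) :
  linear f -> linear g -> (forall u v, f (tens u v) = g (tens u v)) -> f =1 g.
Proof.
have lin (h : tensor U V -> W) : linear h ->
    h 0 = 0 /\ {morph h : s t / s + t}.
  move=> hl.
  have hD s t : h (s + t) = h s + h t by have := hl 1 s t; rewrite !scale1r.
  by split=> //; apply: (@addrI _ (h 0)); rewrite -hD !addr0.
move=> /lin [f0 fD] /lin [g0 gD] fg; elim/tensor_ind.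
- by rewrite f0 g0.
- by move=> s t es et; rewrite fD gD es et.
- exact: fg.
Qed.

Section Functoriality.
Variables (U V U' V' : lmodType k).
Variables (f : {linear U -> U'}) (g : {linear V -> V'}).

Definition tmap : tensor U V -> tensor U' V' :=
  tlift (fun u v => tens (f u) (g v)).

Lemma tmap_bilinl v : linear (fun u => tens (f u) (g v)).
Proof. by move=> a u u'; rewrite linearP tens_linearl. Qed.

Lemma tmap_bilinr u : linear (fun v => tens (f u) (g v)).
Proof. by move=> a v v'; rewrite linearP tens_linearr. Qed.

Lemma tmap_tens u v : tmap (tens u v) = tens (f u) (g v).
Proof. exact: (tlift_tens tmap_bilinl tmap_bilinr). Qed.

Lemma tmap_linear : linear tmap.
Proof. exact: (tlift_linear tmap_bilinl tmap_bilinr). Qed.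

HB.instance Definition _ := GRing.isLinear.Build k (tensor U V) (tensor U' V')
  *:%R tmap tmap_linear.

End Functoriality.
End Tensor.

Record lincat (k : comPzRingType) := LinCat {
  ob :> Type;
  hom : ob -> ob -> lmodType k;
  idm : forall A, hom A A;
  comp : forall A B C, hom B C -> hom A B -> hom A C;
  comp_linearl : forall A B C (f : hom A B), linear (fun g : hom B C => comp g f);
  comp_linearr : forall A B C (g : hom B C), linear (fun f : hom A B => comp g f);
  comp1m : forall A B (f : hom A B), comp (idm B) f = f;
  compm1 : forall A B (f : hom A B), comp f (idm A) = f;
  compA : forall A B C D (h : hom C D) (g : hom B C) (f : hom A B),
    comp h (comp g f) = comp (comp h g) f
}.
Arguments hom {k l}.
Arguments idm {k l}.
Arguments comp {k l A B C}.

Record linfunctor (k : comPzRingType) (a c : lincat k) := LinFunctor {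
  fob :> a -> c;
  fmap : forall A B, {linear hom A B -> hom (fob A) (fob B)};
  fmap_id : forall A, fmap A A (idm A) = idm (fob A);
  fmap_comp : forall A B C (g : hom B C) (f : hom A B),
    fmap A C (comp g f) = comp (fmap B C g) (fmap A B f)
}.
Arguments fmap {k a c} _ {A B}.

Section TensorCategory.
Variables (k : comPzRingType) (a b : lincat k).
Implicit Types P Q S : (a * b)%type.

Definition tc_hom P Q : lmodType k := tensor (hom P.1 Q.1) (hom P.2 Q.2).
Definition tc_id P : tc_hom P P := tens (idm P.1) (idm P.2).

(* The bilinear extension of (f (x) g) o (f' (x) g') = ff' (x) gg'. *)
Definition tc_comp P Q S (t : tc_hom Q S) (s : tc_hom P Q) : tc_hom P S :=
  tlift (fun f g => tlift (fun f' g' => tens (comp f f') (comp g g')) s) t.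

Let in_linl P Q S (f : hom Q.1 S.1) (g : hom Q.2 S.2) (g' : hom P.2 Q.2) :
  linear (fun f' : hom P.1 Q.1 => tens (comp f f') (comp g g')).
Proof. by move=> x u v; rewrite comp_linearr tens_linearl. Qed.
Let in_linr P Q S (f : hom Q.1 S.1) (g : hom Q.2 S.2) (f' : hom P.1 Q.1) :
  linear (fun g' : hom P.2 Q.2 => tens (comp f f') (comp g g')).
Proof. by move=> x u v; rewrite comp_linearr tens_linearr. Qed.
Let out_linl P Q S (s : tc_hom P Q) (g : hom Q.2 S.2) :
  linear (fun f : hom Q.1 S.1 =>
            tlift (fun f' g' => tens (comp f f') (comp g g')) s).
Proof.
move=> x u v; rewrite /tlift scaler_sumr -big_split.
by apply: eq_bigr => p _; rewrite comp_linearl tens_linearl.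
Qed.
Let out_linr P Q S (s : tc_hom P Q) (f : hom Q.1 S.1) :
  linear (fun g : hom Q.2 S.2 =>
            tlift (fun f' g' => tens (comp f f') (comp g g')) s).
Proof.
move=> x u v; rewrite /tlift scaler_sumr -big_split.
by apply: eq_bigr => p _; rewrite comp_linearl tens_linearr.
Qed.

Lemma tc_comp_tens P Q S (f : hom Q.1 S.1) (g : hom Q.2 S.2)
    (f' : hom P.1 Q.1) (g' : hom P.2 Q.2) :
  tc_comp (tens f g : tc_hom Q S) (tens f' g' : tc_hom P Q)
  = tens (comp f f') (comp g g').
Proof.
rewrite /tc_comp (tlift_tens (out_linl _) (out_linr _)).
exact: (tlift_tens (in_linl _ _) (in_linr _ _)).
Qed.

Lemma tc_comp_linearl P Q S (s : tc_hom P Q) :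
  linear (fun t : tc_hom Q S => tc_comp t s).
Proof. exact: (tlift_linear (out_linl _) (out_linr _)). Qed.

Lemma tc_comp_linearr P Q S (t : tc_hom Q S) :
  linear (fun s : tc_hom P Q => tc_comp t s).
Proof.
move=> x u v; rewrite /tc_comp /(tlift _ t) scaler_sumr -big_split.
by apply: eq_bigr => p _; exact: (tlift_linear (in_linl _ _) (in_linr _ _)).
Qed.

Lemma tc_comp1m P Q (s : tc_hom P Q) : tc_comp (tc_id Q) s = s.
Proof.
move: s; apply: linear_tensor_ext => // [|f g]; first exact: tc_comp_linearr.
by rewrite [LHS]tc_comp_tens !comp1m.
Qed.

Lemma tc_compm1 P Q (s : tc_hom P Q) : tc_comp s (tc_id P) = s.
Proof.
move: s; apply: linear_tensor_ext => // [|f g]; first exact: tc_comp_linearl.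
by rewrite [LHS]tc_comp_tens !compm1.
Qed.

Lemma tc_compA P Q S X (h : tc_hom S X) (g : tc_hom Q S) (f : tc_hom P Q) :
  tc_comp h (tc_comp g f) = tc_comp (tc_comp h g) f.
Proof.
move: h; apply: linear_tensor_ext => [x u v|x u v|h1 h2].
- by rewrite tc_comp_linearl.
- by rewrite !tc_comp_linearl.
move: g; apply: linear_tensor_ext => [x u v|x u v|g1 g2].
- by rewrite tc_comp_linearl tc_comp_linearr.
- by rewrite tc_comp_linearr tc_comp_linearl.
move: f; apply: linear_tensor_ext => [x u v|x u v|f1 f2].
- by rewrite !tc_comp_linearr.
- by rewrite tc_comp_linearr.
by rewrite !tc_comp_tens !compA.
Qed.

Definition tensor_cat : lincat k := {|
  ob := (a * b)%type;
  hom := tc_hom;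
  idm := tc_id;
  comp := tc_comp;
  comp_linearl := tc_comp_linearl;
  comp_linearr := tc_comp_linearr;
  comp1m := tc_comp1m;
  compm1 := tc_compm1;
  compA := tc_compA |}.

End TensorCategory.

Section TensorFunctor.
Variables (k : comPzRingType) (a b c d : lincat k).
Variables (phi : linfunctor a c) (psi : linfunctor b d).

Definition tf_ob (P : tensor_cat a b) : tensor_cat c d := (phi P.1, psi P.2).

Definition tf_map (P Q : tensor_cat a b) :
    {linear hom P Q -> hom (tf_ob P) (tf_ob Q)} :=
  tmap (@fmap _ _ _ phi P.1 Q.1) (@fmap _ _ _ psi P.2 Q.2).

Lemma tf_map_id P : tf_map P P (idm P) = idm (tf_ob P).
Proof. by rewrite [LHS]tmap_tens !fmap_id. Qed.

Lemma tf_map_comp P Q S (g : hom Q S) (f : hom P Q) :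
  tf_map P S (comp g f) = comp (tf_map Q S g) (tf_map P Q f).
Proof.
move: g; apply: linear_tensor_ext => [x u v|x u v|g1 g2].
- by rewrite comp_linearl linearP.
- by rewrite linearP comp_linearl.
move: f; apply: linear_tensor_ext => [x u v|x u v|f1 f2].
- by rewrite comp_linearr linearP.
- by rewrite linearP comp_linearr.
rewrite /= tc_comp_tens !tmap_tens.
by rewrite [RHS]tc_comp_tens !fmap_comp.
Qed.

Definition tensor_functor : linfunctor (tensor_cat a b) (tensor_cat c d) :=
  LinFunctor tf_map_id tf_map_comp.

End TensorFunctor.

Section Sieves.
Variables (k : comPzRingType) (a : lincat k).

Record sieve (A : a) := Sieve {
  sieve_set :> forall A', set (hom A' A);
  sieve_submod : forall A', submod_closed (mem (@sieve_set A'));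
  sieve_comp : forall A' A'' (f : hom A' A) (g : hom A'' A'),
    @sieve_set A' f -> @sieve_set A'' (comp f g)
}.
Arguments sieve_set {A} s A' _.

Lemma sieve0 A (R : sieve A) A' : R A' 0.
Proof. by have [/set_mem] := sieve_submod R A'. Qed.

Lemma sieveP A (R : sieve A) A' x (f g : hom A' A) :
  R A' f -> R A' g -> R A' (x *: f + g).
Proof.
have [_ lin] := sieve_submod R A'.
by move=> /mem_set Rf /mem_set Rg; apply/set_mem/lin.
Qed.

Lemma submod_closedP (V : lmodType k) (X : set V) :
  X 0 -> (forall x u v, X u -> X v -> X (x *: u + v)) -> submod_closed (mem X).
Proof.
move=> X0 Xl; split=> [|x u v /set_mem Xu /set_mem Xv]; apply/mem_set => //.
exact: Xl.
Qed.

Definition sieve_max_set (A A' : a) : set (hom A' A) := setT.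
Lemma sieve_max_submod A A' : submod_closed (mem (@sieve_max_set A A')).
Proof. exact: submod_closedP. Qed.
Definition sieve_max (A : a) : sieve A :=
  @Sieve A (@sieve_max_set A) (@sieve_max_submod A) (fun _ _ _ _ _ => I).

Section Pullback.
Variables (A A' : a) (f : hom A' A) (R : sieve A).
Definition sieve_pull_set A'' : set (hom A'' A') :=
  [set g | R A'' (comp f g)]%classic.
Lemma sieve_pull_submod A'' : submod_closed (mem (@sieve_pull_set A'')).
Proof.
have c0 : comp f (0 : hom A'' A') = 0.
  have := comp_linearr f 1 (0 : hom A'' A') 0; rewrite scaler0 addr0 scale1r.
  by move=> /esym/eqP; rewrite -subr_eq0 addrK => /eqP.
apply: submod_closedP => [|x u v]; rewrite /sieve_pull_set /=.
  by rewrite c0; exact: sieve0.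
by rewrite comp_linearr; exact: sieveP.
Qed.
Lemma sieve_pull_comp A1 A2 (g : hom A1 A') (h : hom A2 A1) :
  sieve_pull_set g -> sieve_pull_set (comp g h).
Proof. by rewrite /sieve_pull_set /= compA; exact: sieve_comp. Qed.
Definition sieve_pull : sieve A' := Sieve sieve_pull_submod sieve_pull_comp.
End Pullback.

Section Generated.
Variables (A : a) (I : Type) (D : I -> a) (f : forall i, hom (D i) A).
Definition sieve_gen_set A' : set (hom A' A) :=
  [set g | forall R : sieve A, (forall i, R (D i) (f i)) -> R A' g]%classic.
Lemma sieve_gen_submod A' : submod_closed (mem (@sieve_gen_set A')).
Proof.
apply: submod_closedP => [R _|x u v Ru Rv R Rf]; first exact: sieve0.
by apply: sieveP; [exact: Ru | exact: Rv].
Qed.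
Lemma sieve_gen_comp A1 A2 (g : hom A1 A) (h : hom A2 A1) :
  sieve_gen_set g -> sieve_gen_set (comp g h).
Proof. by move=> Rg R Rf; apply: sieve_comp; exact: Rg. Qed.
Definition sieve_gen : sieve A := Sieve sieve_gen_submod sieve_gen_comp.
End Generated.

Record lintop := LinTop {
  covers :> forall A, set (sieve A);
  top_max : forall A, @covers A (sieve_max A);
  top_pull : forall A (R : sieve A) A' (f : hom A' A),
    @covers A R -> @covers A' (sieve_pull f R);
  top_glue : forall A (R S : sieve A), @covers A R ->
    (forall A' (f : hom A' A), R A' f -> @covers A' (sieve_pull f S)) ->
    @covers A S
}.
Arguments covers l A _.

Definition covering_family (T : lintop) (A : a) (I : Type) (D : I -> a)
  (f : forall i, hom (D i) A) : Prop := T A (sieve_gen f).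

Definition smallest_top_covers (P : lintop -> Prop) (A : a) :
    set (sieve A) :=
  [set R | forall T : lintop, P T -> T A R]%classic.

Lemma smallest_top_max P A : smallest_top_covers P (sieve_max A).
Proof. by move=> T _; exact: top_max. Qed.
Lemma smallest_top_pull P A (R : sieve A) A' (f : hom A' A) :
  smallest_top_covers P R -> smallest_top_covers P (sieve_pull f R).
Proof. by move=> PR T PT; apply: top_pull; exact: PR. Qed.
Lemma smallest_top_glue P A (R S : sieve A) : smallest_top_covers P R ->
  (forall A' (f : hom A' A), R A' f -> smallest_top_covers P (sieve_pull f S)) ->
  smallest_top_covers P S.
Proof.
move=> PR PS T PT; apply: (@top_glue T A R) => [|A' f Rf]; first exact: PR.
exact: PS.
Qed.

(* Smallest only for properties P stable under intersections, such as
   containing given sieves. *)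
Definition smallest_top (P : lintop -> Prop) : lintop :=
  LinTop (@smallest_top_max P) (@smallest_top_pull P) (@smallest_top_glue P).

End Sieves.
Arguments sieve_set {k a A} s A' _.
Arguments covers {k a} l A _.

Section SieveModule.
Variables (k : comPzRingType) (a : lincat k) (A : a) (R : sieve A) (A' : a).

Definition sieve_mod : Type := {f : hom A' A | f \in R A'}.
HB.instance Definition _ := SubChoice.on sieve_mod.
HB.instance Definition _ := GRing.SubChoice_isSubLmodule.Build k (hom A' A)
  _ sieve_mod (sieve_submod R A').

Definition sieve_elt (f : hom A' A) (Rf : R A' f) : sieve_mod :=
  exist (fun g => g \in R A') f (mem_set Rf).

Definition sieve_incl : {linear sieve_mod -> hom A' A} := val.

End SieveModule.

Section Box.
Variables (k : comPzRingType) (a b : lincat k).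

Section BoxSieve.
Variables (A : a) (B : b) (R : sieve A) (S : sieve B).
Let AB : tensor_cat a b := (A, B).

Definition box_map (P : tensor_cat a b) :
    {linear tensor (sieve_mod R P.1) (sieve_mod S P.2) -> hom P AB} :=
  tmap (sieve_incl R P.1) (sieve_incl S P.2).

Definition sieve_box_set (P : tensor_cat a b) : set (hom P AB) :=
  range (box_map P).

Lemma sieve_box_submod P : submod_closed (mem (@sieve_box_set P)).
Proof.
apply: submod_closedP => [|x _ _ [u _ <-] [v _ <-]].
  by exists 0 => //; rewrite linear0.
by exists (x *: u + v) => //; rewrite linearP.
Qed.

Lemma sieve_box_comp P Q (f : hom P AB) (g : hom Q P) :
  sieve_box_set f -> sieve_box_set (comp f g).
Proof.
have [bx0 bxl] := sieve_box_submod Q.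
have bxD u v : sieve_box_set u -> sieve_box_set v ->
    sieve_box_set (u + v : hom Q AB).
  by move=> /mem_set bu /mem_set bv; rewrite -[u]scale1r; apply/set_mem/bxl.
have lin0 (V W : lmodType k) (h : V -> W) : linear h -> h 0 = 0.
  by move=> hl; have := hl (-1) 0 0; rewrite !scaleN1r !addNr.
have linD (V W : lmodType k) (h : V -> W) : linear h -> {morph h : u v / u + v}.
  by move=> hl u v; have := hl 1 u v; rewrite !scale1r.
case=> t _ <-; elim/tensor_ind: t => [|s t IHs IHt|r s].
- by rewrite linear0 (lin0 _ _ _ (comp_linearl g)); exact/set_mem.
- by rewrite linearD (linD _ _ _ (comp_linearl g)); exact: bxD.
elim/tensor_ind: g => [|u v IHu IHv|u v].
- by rewrite (lin0 _ _ _ (comp_linearr _)); exact/set_mem.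
- by rewrite (linD _ _ _ (comp_linearr _)); exact: bxD.
have ru : R Q.1 (comp (val r) u).
  by apply/sieve_comp/set_mem; exact: (valP r).
have sv : S Q.2 (comp (val s) v).
  by apply/sieve_comp/set_mem; exact: (valP s).
exists (tens (sieve_elt ru) (sieve_elt sv)).
  by [].
by rewrite /box_map /= !tmap_tens /= [RHS]tc_comp_tens.
Qed.

Definition sieve_box : sieve AB := Sieve sieve_box_submod sieve_box_comp.

End BoxSieve.

Definition top_box (Ta : lintop a) (Tb : lintop b) : lintop (tensor_cat a b) :=
  smallest_top (fun T : lintop (tensor_cat a b) =>
    (forall A B (R : sieve A), Ta A R ->
       T (A, B) (sieve_box R (sieve_max B))) /\
    (forall A B (S : sieve B), Tb B S ->
       T (A, B) (sieve_box (sieve_max A) S))).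

Lemma top_boxl (Ta : lintop a) (Tb : lintop b) A B (R : sieve A) :
  Ta A R -> top_box Ta Tb (A, B) (sieve_box R (sieve_max B)).
Proof. by move=> TR T [+ _]; apply. Qed.

Lemma top_boxr (Ta : lintop a) (Tb : lintop b) A B (S : sieve B) :
  Tb B S -> top_box Ta Tb (A, B) (sieve_box (sieve_max A) S).
Proof. by move=> TS T [_ +]; apply. Qed.

Lemma top_box_min (Ta : lintop a) (Tb : lintop b)
    (T : lintop (tensor_cat a b)) :
  (forall A B (R : sieve A), Ta A R ->
     T (A, B) (sieve_box R (sieve_max B))) ->
  (forall A B (S : sieve B), Tb B S ->
     T (A, B) (sieve_box (sieve_max A) S)) ->
  forall P (R : sieve P), top_box Ta Tb P R -> T P R.
Proof. by move=> TR TS P R; apply. Qed.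

End Box.

Section Conditions.
Variables (k : comPzRingType) (a c : lincat k).
Variables (Ta : lintop a) (Tc : lintop c) (phi : linfunctor a c).

Definition cond_G : Prop :=
  forall C : c, exists (I : Type) (D : I -> a) (f : forall i, hom (phi (D i)) C),
    covering_family Tc f.

Definition cond_F : Prop :=
  forall (A A' : a) (x : hom (phi A) (phi A')),
  exists (I : Type) (D : I -> a) (u : forall i, hom (D i) A)
         (f : forall i, hom (D i) A'),
    covering_family Ta u /\ forall i, comp x (fmap phi (u i)) = fmap phi (f i).

Definition cond_FF : Prop :=
  forall (A A' : a) (x : hom A A'), fmap phi x = 0 ->
  exists (I : Type) (D : I -> a) (u : forall i, hom (D i) A),
    covering_family Ta u /\ forall i, comp x (u i) = 0.

Definition sieve_image (A : a) (R : sieve A) : sieve (phi A) :=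
  sieve_gen (fun i : {A' : a & {f : hom A' A | R A' f}} =>
    fmap phi (sval (projT2 i))).

Definition cond_LC : Prop :=
  [/\ cond_G, cond_F, cond_FF
    & forall (A : a) (R : sieve A), Ta A R <-> Tc (phi A) (sieve_image R)].

End Conditions.

(* Main.v *)
Require Import Defs.
From mathcomp Require Import all_boot all_order all_algebra.
From mathcomp Require Import boolp classical_sets.
Import Defs.

Set Implicit Arguments.
Unset Strict Implicit.
Unset Printing Implicit Defensive.

Import GRing.Theory.
Local Open Scope ring_scope.

(** Everything is phrased with two devices.  For a topology T and a sieve S, the
    morphisms that lie in S locally, i.e. those f for which [sieve_pull f S] is
    covering, form again a sieve, [sieve_closure]; glueing says that S covers as
    soon as a covering sieve lies in its closure, so a covering property may be
    checked on generators only.  Applied to the zero sieve, the closure consists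
    of the locally zero morphisms, and [eqloc] is the resulting congruence.  In
    these terms (F) says that every morphism x between objects in the image of
    phi lifts on a covering sieve ([cond_FP]), and (FF) that morphisms with the
    same image under phi are locally equal ([cond_FFP]).

    The topology of the tensor product contains R box S whenever R and S cover
    ([top_boxM]).  As the generators of R box S are pure tensors, (G) follows,
    and so does (F): it holds for pure tensors, and the morphisms that lift
    locally are stable under sums.

    The heart of the matter is (FF), where x and x' in a (x) b have the same image
    in c (x) d.  That two formal sums of pure tensors have the same value is
    witnessed by a finite chain of elementary relations.  The intermediate sums of
    such a chain involve arbitrary morphisms of c and d, not in the image of phi
    and psi, but by (F) each of them lifts to a (x) b on some R box S with R
    and S covering.  [lifts_tensor_eq] shows by induction on the chain that
    lifts of equal sums are locally equal: each elementary relation holds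
    upstairs up to replacing factors by others with the same image, which (FF)
    for phi and psi makes harmless, and transitivity is where a lift of the
    middle sum has to be found after restriction.

    For (LC), both implications come from the minimality of the tensor
    topology.  The sieves all of whose pullbacks have a covering image form a
    topology on a (x) b ([top_image]); the sieves all of whose pullbacks to
    objects in the image have a covering inverse image form a topology on
    c (x) d ([top_preim]).  Each contains the generating boxes, because the
    pullback of a box along any morphism contains a box of covering sieves
    ([top_box_pull]).  Hence images and inverse images of covering sieves cover,
    and a sieve R is covering as soon as the inverse image of its image is,
    since by (F) and (FF) the latter lies locally in R ([cover_preim_image]). *)

(** * Composition and sieves *)

Section Composition.
Variables (k : comPzRingType) (a : lincat k).

Lemma linear_map0 (U V : lmodType k) (f : U -> V) : linear f -> f 0 = 0.
Proof. by move=> fl; have := fl (-1) 0 0; rewrite !scaleN1r !addNr. Qed.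

Lemma comp0m (A B C : a) (f : hom A B) : comp (0 : hom B C) f = 0.
Proof. exact: linear_map0 (comp_linearl f). Qed.

Lemma compm0 (A B C : a) (g : hom B C) : comp g (0 : hom A B) = 0.
Proof. exact: linear_map0 (comp_linearr g). Qed.

Lemma compDl (A B C : a) (g g' : hom B C) (f : hom A B) :
  comp (g + g') f = comp g f + comp g' f.
Proof. by have := comp_linearl f 1 g g'; rewrite !scale1r. Qed.

Lemma compZl (A B C : a) x (g : hom B C) (f : hom A B) :
  comp (x *: g) f = x *: comp g f.
Proof. by have := comp_linearl f x g 0; rewrite comp0m !addr0. Qed.

Lemma compBl (A B C : a) (g g' : hom B C) (f : hom A B) :
  comp (g - g') f = comp g f - comp g' f.
Proof. by rewrite -scaleN1r compDl compZl scaleN1r. Qed.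

End Composition.

Section SieveConstructions.
Variables (k : comPzRingType) (a : lincat k).

Definition mk_sieve (A : a) (X : forall A', set (hom A' A))
    (X0 : forall A', X A' 0)
    (XP : forall A' x (u v : hom A' A), X A' u -> X A' v -> X A' (x *: u + v))
    (Xc : forall A' A'' (f : hom A' A) (g : hom A'' A'),
      X A' f -> X A'' (comp f g)) : sieve A :=
  Sieve (fun A' => submod_closedP (X0 A') (@XP A')) Xc.

(** Stability of topologies under enlarging sieves rests on this: the axioms only
    say that the maximal sieve itself covers, so a sieve with all morphisms as
    members must be equal to it. *)
Lemma sieve_ext (A : a) (R S : sieve A) :
  (forall A' (f : hom A' A), R A' f <-> S A' f) -> R = S.
Proof.
case: R S => [R R1 R2] [S S1 S2] /= RS.
have eRS : R = S.
  apply: functional_extensionality_dep => A'; apply/funext => f.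
  exact/propext/RS.
by subst S; congr Sieve; exact: Prop_irrelevance.
Qed.

Definition sub_sieve (A : a) (R S : sieve A) : Prop :=
  forall A' (f : hom A' A), R A' f -> S A' f.

Lemma sieveD (A : a) (R : sieve A) A' (f g : hom A' A) :
  R A' f -> R A' g -> R A' (f + g).
Proof. by move=> Rf Rg; rewrite -[f]scale1r; exact: sieveP. Qed.

Lemma sieveN (A : a) (R : sieve A) A' (f : hom A' A) :
  R A' f -> R A' (- f).
Proof.
move=> Rf; rewrite -scaleN1r -[_ *: _]addr0.
by apply: sieveP => //; exact: sieve0.
Qed.

Lemma sieve_gen_sub (A : a) (I : Type) (D : I -> a) (f : forall i, hom (D i) A)
    (R : sieve A) :
  (forall i, R (D i) (f i)) -> sub_sieve (sieve_gen f) R.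
Proof. by move=> Rf A' g; apply. Qed.

Lemma sieve_gen_mem (A : a) (I : Type) (D : I -> a) (f : forall i, hom (D i) A)
    i : sieve_gen f (D i) (f i).
Proof. by move=> R; apply. Qed.

Lemma sieve_pullE (A A' A'' : a) (f : hom A' A) (R : sieve A) (g : hom A'' A') :
  sieve_pull f R A'' g = R A'' (comp f g).
Proof. by []. Qed.

Lemma sieve_pullA (A A' A'' : a) (f : hom A' A) (g : hom A'' A') (R : sieve A) :
  sieve_pull g (sieve_pull f R) = sieve_pull (comp f g) R.
Proof.
by apply: sieve_ext => A1 h; rewrite !sieve_pullE compA.
Qed.

Lemma sieve_pull1 (A : a) (R : sieve A) : sieve_pull (idm A) R = R.
Proof.
by apply: sieve_ext => A1 h; rewrite sieve_pullE comp1m.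
Qed.

(** All the members of a sieve, as a family: the canonical witness when a covering
    family is asked for and a covering sieve is known. *)
Definition sieve_index (A : a) (R : sieve A) : Type :=
  {A' : a & {f : hom A' A | R A' f}}.

Definition sieve_arrow (A : a) (R : sieve A) (i : sieve_index R) :
  hom (projT1 i) A := sval (projT2 i).

Definition sieve_zero (A : a) : sieve A.
Proof.
apply: (@mk_sieve A (fun A' => [set f | f = 0]%classic)) => //=.
- by move=> A' x u v -> ->; rewrite scaler0 addr0.
- by move=> A' A'' f g ->; rewrite comp0m.
Defined.

Lemma sieve_zeroE (A A' : a) (f : hom A' A) : sieve_zero A A' f = (f = 0).
Proof. by []. Qed.

Definition sieve_meet (A : a) (R S : sieve A) : sieve A.
Proof.
apply: (@mk_sieve A (fun A' => [set f | R A' f /\ S A' f]%classic)) => /=.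
- by move=> A'; split; exact: sieve0.
- by move=> A' x u v [Ru Su] [Rv Sv]; split; exact: sieveP.
- by move=> A' A'' f g [Rf Sf]; split; exact: sieve_comp.
Defined.

End SieveConstructions.
Arguments sieve_gen_mem {k a A I D} f i.

(** * Sieves and morphisms up to a topology *)

Section Local.
Variables (k : comPzRingType) (a : lincat k) (T : lintop a).

Lemma cover_all (A : a) (R : sieve A) :
  (forall A' (f : hom A' A), R A' f) -> T A R.
Proof.
move=> Rall; have -> : R = sieve_max A by apply: sieve_ext.
exact: top_max.
Qed.

Lemma cover_sub (A : a) (R S : sieve A) : sub_sieve R S -> T A R -> T A S.
Proof.
move=> RS TR; apply: top_glue TR _ => A' f /RS Sf.
by apply: cover_all => A'' g; exact: sieve_comp.
Qed.

Lemma cover_meet (A : a) (R S : sieve A) :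
  T A R -> T A S -> T A (sieve_meet R S).
Proof.
move=> TR TS; apply: top_glue TR _ => A' f Rf.
apply: cover_sub (top_pull f TS) => A'' g Sg.
by split=> //; exact: sieve_comp.
Qed.

(** It is a submodule because covering sieves have covering intersections, and
    stable under composition because topologies are stable under pullback. *)
Definition sieve_closure (A : a) (S : sieve A) : sieve A.
Proof.
apply: (@mk_sieve _ _ A
  (fun A' => [set f | T A' (sieve_pull f S)]%classic)) => /=.
- move=> A'; apply: cover_all => A'' g /=.
  by rewrite /sieve_pull_set /= comp0m; exact: sieve0.
- move=> A' x u v Tu Tv; apply: cover_sub (cover_meet Tu Tv).
  move=> A'' g [] /= Su Sv.
  by rewrite /sieve_pull_set /= comp_linearl; exact: sieveP.
- by move=> A' A'' f g Tf; rewrite -sieve_pullA; exact: top_pull.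
Defined.

Lemma sieve_closureE (A : a) (S : sieve A) A' (f : hom A' A) :
  sieve_closure S A' f = T A' (sieve_pull f S).
Proof. by []. Qed.

(** Glueing, with its local condition turned into an inclusion of sieves: when R
    is generated by a family, the condition is only needed on that family. *)
Lemma cover_closure (A : a) (R S : sieve A) :
  T A R -> sub_sieve R (sieve_closure S) -> T A S.
Proof. by move=> TR RS; apply: top_glue TR _ => A' f /RS. Qed.

Lemma sieve_family_cover (A : a) (R : sieve A) :
  T A R -> covering_family T (@sieve_arrow _ _ A R).
Proof.
apply: cover_sub => A' f Rf.
pose i : sieve_index R := existT _ A' (exist _ f Rf).
exact: (sieve_gen_mem (@sieve_arrow _ _ A R) i).
Qed.

(** Equality after restriction to a covering sieve.  Being defined by membership
    in a sieve, it inherits compatibility with the module structure. *)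
Definition eqloc (A' A : a) (f g : hom A' A) : Prop :=
  sieve_closure (sieve_zero A) A' (f - g).

Lemma eqloc_refl (A' A : a) (f : hom A' A) : eqloc f f.
Proof. by rewrite /eqloc subrr; exact: sieve0. Qed.

Lemma eqloc_sym (A' A : a) (f g : hom A' A) : eqloc f g -> eqloc g f.
Proof. by move=> fg; rewrite /eqloc -opprB; exact: sieveN. Qed.

Lemma eqloc_trans (A' A : a) (f g h : hom A' A) :
  eqloc f g -> eqloc g h -> eqloc f h.
Proof. by move=> fg gh; rewrite /eqloc -(subrKA g); exact: sieveD. Qed.

Lemma eqlocD (A' A : a) (f g f' g' : hom A' A) :
  eqloc f g -> eqloc f' g' -> eqloc (f + f') (g + g').
Proof. by move=> fg fg'; rewrite /eqloc opprD addrACA; exact: sieveD. Qed.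

(** Combined with [cover_closure], this makes local equality itself local. *)
Lemma closure_diffE (A A' A'' : a) (f g : hom A' A) (h : hom A'' A') :
  sieve_closure (sieve_pull (f - g) (sieve_zero A)) A'' h =
  eqloc (comp f h) (comp g h).
Proof. by rewrite sieve_closureE sieve_pullA compBl. Qed.

Lemma closure_eqloc (A' A : a) (R : sieve A) (f g : hom A' A) :
  eqloc f g -> R A' g -> sieve_closure R A' f.
Proof.
move=> fg Rg; apply: cover_sub fg => A'' u /= fgu.
rewrite /sieve_pull_set /= -[f](subrK g) compDl fgu add0r.
exact: sieve_comp.
Qed.

End Local.

(** * Functors and sieves *)

Section FunctorSieves.
Variables (k : comPzRingType) (a c : lincat k) (phi : linfunctor a c).

(** The sieve on which x comes from [a]; the lifts are moreover required to lie
    in R, which is maximal when only their existence matters. *)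
Definition lift_sieve (A A' : a) (R : sieve A') (x : hom (phi A) (phi A')) :
  sieve A.
Proof.
apply: (@mk_sieve _ _ A (fun A1 => [set u | exists2 f, R A1 f &
  comp x (fmap phi u) = fmap phi f]%classic)) => /=.
- by move=> A1; exists 0; [exact: sieve0 | rewrite !linear0 compm0].
- move=> A1 l u v [f Rf xu] [g Rg xv]; exists (l *: f + g); first exact: sieveP.
  by rewrite !linearP comp_linearr xu xv.
- move=> A1 A2 u v [f Rf xu]; exists (comp f v); first exact: sieve_comp.
  by rewrite !fmap_comp compA xu.
Defined.

Definition sieve_preim (A : a) (S : sieve (phi A)) : sieve A.
Proof.
apply: (@mk_sieve _ _ A
  (fun A1 => [set u | S (phi A1) (fmap phi u)]%classic)) => /=.
- by move=> A1; rewrite linear0; exact: sieve0.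
- by move=> A1 l u v Su Sv; rewrite linearP; exact: sieveP.
- by move=> A1 A2 u v Su; rewrite fmap_comp; exact: sieve_comp.
Defined.

Lemma sieve_image_mem (A : a) (R : sieve A) A' (f : hom A' A) :
  R A' f -> sieve_image phi R (phi A') (fmap phi f).
Proof.
by move=> Rf S; apply: (fun RS => RS (existT _ A' (exist _ f Rf))).
Qed.

Lemma sieve_image_sub (A : a) (R : sieve A) (S : sieve (phi A)) :
  (forall A' (f : hom A' A), R A' f -> S (phi A') (fmap phi f)) ->
  sub_sieve (sieve_image phi R) S.
Proof. by move=> RS; apply: sieve_gen_sub => -[A' [f Rf]] /=; exact: RS. Qed.

Variable Ta : lintop a.

Lemma cond_FP : cond_F Ta phi <->
  forall (A A' : a) (x : hom (phi A) (phi A')),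
    Ta A (lift_sieve (sieve_max A') x).
Proof.
split=> [Fphi A A' x | Fphi A A' x].
  have [I [D [u [f [Tu xu]]]]] := Fphi A A' x.
  by apply: cover_sub Tu; apply: sieve_gen_sub => i; exists (f i).
pose R := lift_sieve (sieve_max A') x.
have lift (i : sieve_index R) :
    exists f : hom (projT1 i) A',
      comp x (fmap phi (sieve_arrow i)) = fmap phi f.
  by case: (svalP (projT2 i)) => f _ xu; exists f.
exists (sieve_index R), (fun i => projT1 i), (@sieve_arrow _ _ _ R),
  (fun i => sval (cid (lift i))).
by split=> [|i]; [exact/sieve_family_cover/Fphi | case: cid].
Qed.

Lemma cond_FFP : cond_FF Ta phi <->
  forall (A A' : a) (f g : hom A A'), fmap phi f = fmap phi g -> eqloc Ta f g.
Proof.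
split=> [FFphi A A' f g fg | FFphi A A' x x0].
  have [|I [D [u [Tu xu]]]] := FFphi A A' (f - g).
    by rewrite linearB /= fg subrr.
  by apply: cover_sub Tu; apply: sieve_gen_sub => i; exact: xu.
have Tx : Ta A (sieve_pull x (sieve_zero A')).
  by rewrite -[x]subr0; apply: FFphi; rewrite x0 linear0.
exists (sieve_index (sieve_pull x (sieve_zero A'))), (fun i => projT1 i),
  (@sieve_arrow _ _ _ _).
by split=> [|[A1 [u]]] //; exact: sieve_family_cover.
Qed.

(** Lifting locally is a property of morphisms between objects in the image of
    [phi], whereas a sieve on [phi A] has members with any source; quantifying
    over all restrictions along morphisms out of the image gives a sieve on
    [phi A]. *)
Definition locally_lifting_sieve (A : a) (R : sieve A) : sieve (phi A).
Proof.
apply: (@mk_sieve _ _ (phi A) (fun C => [set h |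
  forall A' (g : hom (phi A') C),
    Ta A' (lift_sieve R (comp h g))]%classic)) => /=.
- move=> C A' g; apply: cover_all => A1 u; exists 0; first exact: sieve0.
  by rewrite linear0 !comp0m.
- move=> C l h h' Th Th' A' g.
  apply: cover_sub (cover_meet (Th A' g) (Th' A' g)).
  move=> A1 u [[f Rf hf] [f' Rf' hf']].
  exists (l *: f + f'); first exact: sieveP.
  by rewrite linearP !comp_linearl hf hf'.
- by move=> C C' h g Th A' g'; rewrite -compA; exact: Th.
Defined.

(** The members of the image sieve form the smallest sieve that contains the
    morphisms fmap phi r, r in R, and those lift locally to R: a morphism
    (fmap phi r) g lifts to r f where f is a local lift of g. *)
Lemma image_lift (A : a) (R : sieve A) : cond_F Ta phi ->
  forall A' (h : hom (phi A') (phi A)), sieve_image phi R (phi A') h ->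
  Ta A' (lift_sieve R h).
Proof.
move=> /cond_FP Fphi A' h.
suff subL : sub_sieve (sieve_image phi R) (locally_lifting_sieve R).
  by move=> /subL /(_ A' (idm _)); rewrite compm1.
apply: sieve_image_sub => A1 r Rr A2 g.
apply: cover_sub (Fphi _ _ g) => A3 u [f _ gu].
exists (comp r f); first exact: sieve_comp.
by rewrite -compA gu fmap_comp.
Qed.

(** If [fmap phi f] is in the image of R then, locally, it has the same image as a
    member of R, so that f itself is locally equal to a member of R. *)
Lemma cover_preim_image (A : a) (R : sieve A) :
  cond_F Ta phi -> cond_FF Ta phi ->
  Ta A (sieve_preim (sieve_image phi R)) -> Ta A R.
Proof.
move=> Fphi /cond_FFP FFphi TR; apply: (cover_closure TR) => A' f Rf.
have TL := image_lift Fphi Rf.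
apply: (cover_closure TL) => A1 u [r Rr fu].
rewrite -fmap_comp in fu; rewrite /= sieve_pullA.
exact: closure_eqloc (FFphi _ _ _ _ fu) Rr.
Qed.

Variable Tc : lintop c.

(** By (LC) the image of the inverse image has to cover.  Any s in S factors
    through it locally: (G) restricts s to objects in the image, (F) lifts these
    restrictions to morphisms of [a], and the lifts are in the inverse image. *)
Lemma cover_preim : cond_LC Ta Tc phi ->
  forall (A : a) (S : sieve (phi A)), Tc (phi A) S -> Ta A (sieve_preim S).
Proof.
move=> [Gphi /cond_FP Fphi _ LCphi] A S TS; apply/LCphi.
apply: (cover_closure TS) => C s Ss.
have [I [D [g Tg]]] := Gphi C.
apply: (cover_closure Tg); apply: sieve_gen_sub => i.
have /LCphi := Fphi _ _ (comp s (g i)).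
apply: cover_sub; apply: sieve_image_sub => A1 u [f _ sgu].
rewrite !sieve_pullE compA sgu.
by apply: sieve_image_mem; rewrite /= -sgu; do 2 apply: sieve_comp.
Qed.

(** The quantification over pullbacks builds stability under pullback into the
    definition, so that no condition on [phi] is needed. *)
Definition top_image : lintop a.
Proof.
apply: (@LinTop _ a (fun A => [set R | forall A' (f : hom A' A),
  Tc (phi A') (sieve_image phi (sieve_pull f R))]%classic)) => /=.
- move=> A A' f; apply: cover_all => C h.
  rewrite -[h]comp1m -fmap_id; apply: sieve_comp.
  exact: sieve_image_mem.
- by move=> A R A' f TR A1 g; rewrite sieve_pullA; exact: TR.
- move=> A R S TR TS A' g.
  apply: (cover_closure (TR A' g)); apply: sieve_image_sub => A1 h Rh.
  have := TS _ _ Rh _ (idm A1); rewrite sieve_pull1; apply: cover_sub.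
  apply: sieve_image_sub => A2 u Su.
  rewrite sieve_pullE -fmap_comp; apply: sieve_image_mem.
  by rewrite sieve_pullE compA.
Defined.

(** The analogue of [top_image] for inverse images; here all morphisms from
    objects in the image are quantified over, since only a sieve on such an
    object has an inverse image. *)
Definition top_preim : lintop c.
Proof.
apply: (@LinTop _ c (fun C => [set S | forall A (g : hom (phi A) C),
  Ta A (sieve_preim (sieve_pull g S))]%classic)) => /=.
- by move=> C A g; exact: cover_all.
- by move=> C S C' f TS A g; rewrite sieve_pullA; exact: TS.
- move=> C S S' TS TS' A g.
  apply: (cover_closure (TS A g)) => A1 u Su.
  have := TS' _ _ Su _ (idm _); rewrite sieve_pull1; apply: cover_sub => A2 v.
  by rewrite /= /sieve_pull_set /= /sieve_pull_set /= fmap_comp compA.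
Defined.

End FunctorSieves.

(** * Tensor products of sieves *)

Section BoxSieves.
Variables (k : comPzRingType) (a b : lincat k).
Local Notation ab := (tensor_cat a b).

(** A pure tensor, typed as a morphism of the tensor product category so that
    composition with it is found. *)
Definition htens (A' A : a) (B' B : b) (f : hom A' A) (g : hom B' B) :
  hom ((A', B') : ab) (A, B) := tens f g.

Lemma comp_htens (A A' A'' : a) (B B' B'' : b) (f : hom A' A) (g : hom B' B)
    (f' : hom A'' A') (g' : hom B'' B') :
  comp (htens f g) (htens f' g') = htens (comp f f') (comp g g').
Proof. exact: tc_comp_tens. Qed.

Lemma htensPl (A' A : a) (B' B : b) (x : k) (f f' : hom A' A) (g : hom B' B) :
  htens (x *: f + f') g = x *: htens f g + htens f' g.
Proof. exact: tens_linearl. Qed.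

Lemma htensPr (A' A : a) (B' B : b) (x : k) (f : hom A' A) (g g' : hom B' B) :
  htens f (x *: g + g') = x *: htens f g + htens f g'.
Proof. exact: tens_linearr. Qed.

Lemma htens0l (A' A : a) (B' B : b) (g : hom B' B) :
  htens (0 : hom A' A) g = 0.
Proof. exact: linear_map0 (tens_linearl g). Qed.

Lemma htens0r (A' A : a) (B' B : b) (f : hom A' A) :
  htens f (0 : hom B' B) = 0.
Proof. exact: linear_map0 (tens_linearr f). Qed.

Lemma htens_ind (A' A : a) (B' B : b) (P : hom ((A', B') : ab) (A, B) -> Prop) :
  P 0 -> (forall s t, P s -> P t -> P (s + t)) ->
  (forall f g, P (htens f g)) -> forall t, P t.
Proof. exact: tensor_ind. Qed.

(** With one factor fixed, membership of a pure tensor in a sieve on (A, B) is a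
    sieve condition on the other factor.  Generators of the two factors can
    therefore be treated one after the other. *)
Section SliceSieves.
Variables (A : a) (B : b) (X : sieve ((A, B) : ab)).

Definition slice_sievel (B' : b) (g : hom B' B) : sieve A.
Proof.
apply: (@mk_sieve _ _ A
  (fun A' => [set f | X (A', B') (htens f g)]%classic)) => /=.
- by move=> A'; rewrite htens0l; exact: sieve0.
- by move=> A' x u v Xu Xv; rewrite htensPl; exact: sieveP.
- move=> A' A'' f h Xf; rewrite -[g]compm1 -comp_htens; exact: sieve_comp.
Defined.

Definition slice_siever (A' : a) (f : hom A' A) : sieve B.
Proof.
apply: (@mk_sieve _ _ B
  (fun B' => [set g | X (A', B') (htens f g)]%classic)) => /=.
- by move=> B'; rewrite htens0r; exact: sieve0.
- by move=> B' x u v Xu Xv; rewrite htensPr; exact: sieveP.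
- move=> B' B'' g h Xg; rewrite -[f]compm1 -comp_htens; exact: sieve_comp.
Defined.

Lemma sieve_box_sub (R : sieve A) (S : sieve B) :
  (forall A' B' (r : hom A' A) (s : hom B' B),
     R A' r -> S B' s -> X (A', B') (htens r s)) ->
  sub_sieve (sieve_box R S) X.
Proof.
move=> RSX [A' B'] h [t _ <-]; elim/tensor_ind: t => [|s t Xs Xt|r s].
- by rewrite linear0; exact: sieve0.
- by rewrite linearD; exact: sieveD.
- rewrite /box_map /= tmap_tens; apply: RSX; apply: set_mem.
    exact: (valP r).
  exact: (valP s).
Qed.

Lemma sieve_box_gen_sub (I J : Type) (D : I -> a) (E : J -> b)
    (f : forall i, hom (D i) A) (g : forall j, hom (E j) B) :
  (forall i j, X (D i, E j) (htens (f i) (g j))) ->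
  sub_sieve (sieve_box (sieve_gen f) (sieve_gen g)) X.
Proof.
move=> Xfg; apply: sieve_box_sub => A' B' r s fr gs.
apply: (sieve_gen_sub (R := slice_siever r) _ gs) => j.
by apply: (sieve_gen_sub (R := slice_sievel (g j)) _ fr) => i; exact: Xfg.
Qed.

End SliceSieves.

Lemma sieve_box_mem (A : a) (B : b) (R : sieve A) (S : sieve B)
    A' B' (r : hom A' A) (s : hom B' B) :
  R A' r -> S B' s -> sieve_box R S (A', B') (htens r s).
Proof.
move=> Rr Ss; exists (tens (sieve_elt Rr) (sieve_elt Ss)) => //.
by rewrite /box_map /= tmap_tens.
Qed.

Variables (Ta : lintop a) (Tb : lintop b).

(** The generating sieve R box b(-, B) covers, and the pullback of R box S to one
    of its generators r (x) v contains the generating sieve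
    a(-, A') box v^-1 S. *)
Lemma top_boxM (A : a) (B : b) (R : sieve A) (S : sieve B) :
  Ta A R -> Tb B S -> top_box Ta Tb (A, B) (sieve_box R S).
Proof.
move=> TR TS; apply: (cover_closure (top_boxl B TR)).
apply: sieve_box_sub => A' B' r v Rr _.
have Tv : top_box Ta Tb (A', B') (sieve_box (sieve_max A') (sieve_pull v S)).
  by apply: top_boxr; exact: top_pull.
apply: cover_sub Tv; apply: sieve_box_sub => A1 B1 u s _ Ss.
rewrite sieve_pullE comp_htens.
by apply: sieve_box_mem => //; exact: sieve_comp.
Qed.

(** For h = f (x) g the sieves f^-1 R and g^-1 S do; for a sum, intersect the
    sieves found for the summands. *)
Lemma top_box_pull (A A' : a) (B B' : b) (R : sieve A) (S : sieve B)
    (h : hom ((A', B') : ab) (A, B)) : Ta A R -> Tb B S ->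
  exists R' S', [/\ Ta A' R', Tb B' S' &
    sub_sieve (sieve_box R' S') (sieve_pull h (sieve_box R S))].
Proof.
move=> TR TS; elim/htens_ind: h => [|h h'|f g].
- exists (sieve_max A'), (sieve_max B'); split; try exact: top_max.
  by move=> P u _; rewrite sieve_pullE comp0m; exact: sieve0.
- move=> [R1 [S1 [TR1 TS1 sub1]]] [R2 [S2 [TR2 TS2 sub2]]].
  exists (sieve_meet R1 R2), (sieve_meet S1 S2).
  split; try exact: cover_meet.
  apply: sieve_box_sub => A1 B1 r s [R1r R2r] [S1s S2s].
  rewrite sieve_pullE compDl; apply: sieveD.
    by apply: sub1; exact: sieve_box_mem.
  by apply: sub2; exact: sieve_box_mem.
- exists (sieve_pull f R), (sieve_pull g S); split; try exact: top_pull.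
  apply: sieve_box_sub => A1 B1 r s Rr Ss.
  by rewrite sieve_pullE comp_htens; exact: sieve_box_mem.
Qed.

End BoxSieves.

(** * Tensor products of functors *)

Section TensorFunctor.
Variables (k : comPzRingType) (a b c d : lincat k).
Variables (phi : linfunctor a c) (psi : linfunctor b d).
Local Notation Phi := (tensor_functor phi psi).
Local Notation ab := (tensor_cat a b).
Local Notation cd := (tensor_cat c d).

Lemma fmap_htens (A A' : a) (B B' : b) (f : hom A A') (g : hom B B') :
  fmap Phi (htens f g : hom ((A, B) : ab) (A', B')) =
  htens (fmap phi f) (fmap psi g).
Proof. exact: tmap_tens. Qed.

Lemma tensor_G (Tc : lintop c) (Td : lintop d) :
  cond_G Tc phi -> cond_G Td psi -> cond_G (top_box Tc Td) Phi.
Proof.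
move=> Gphi Gpsi [C D]; have [I [X [f Tf]]] := Gphi C.
have [J [Y [g Tg]]] := Gpsi D.
exists (I * J)%type, (fun ij => (X ij.1, Y ij.2)).
exists (fun ij => htens (f ij.1) (g ij.2)).
have Tfg := top_boxM Tf Tg.
apply: cover_sub Tfg; apply: sieve_box_gen_sub => i j.
exact: (sieve_gen_mem
  (fun ij : I * J => htens (f ij.1) (g ij.2)) (i, j)).
Qed.

Variables (Ta : lintop a) (Tb : lintop b).
Local Notation Tab := (top_box Ta Tb).

Lemma tensor_F : cond_F Ta phi -> cond_F Tb psi -> cond_F Tab Phi.
Proof.
move=> /cond_FP Fphi /cond_FP Fpsi; apply/cond_FP => -[A B] [A' B'] h.
elim/htens_ind: h => [|h h' Th Th'|y z].
- apply: cover_all => P u; exists 0 => //.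
  by rewrite comp0m linear0.
- apply: cover_sub (cover_meet Th Th') => P u [[f _ hf] [f' _ hf']].
  by exists (f + f') => //; rewrite compDl hf hf' linearD.
- have Tyz := top_boxM (Fphi _ _ y) (Fpsi _ _ z).
  apply: cover_sub Tyz; apply: sieve_box_sub => A1 B1 u v [f _ yu] [g _ zv].
  by exists (htens f g) => //; rewrite !fmap_htens comp_htens yu zv.
Qed.

Section LocalLifts.
Hypotheses (Fphi : cond_F Ta phi) (Fpsi : cond_F Tb psi).
Variables (A A' : a) (B B' : b).
Local Notation pairs := (seq (hom (phi A) (phi A') * hom (psi B) (psi B'))).

(** x is a termwise lift of the formal sum s, restricted along u and v.  The
    formal sum is kept as a list, since its value in the tensor product does not
    remember which terms to lift. *)
Fixpoint lifts A1 B1 (u : hom A1 A) (v : hom B1 B) (s : pairs)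
    (x : hom ((A1, B1) : ab) (A', B')) : Prop :=
  if s is (y, z) :: s' then
    exists f g x', [/\ fmap phi f = comp y (fmap phi u),
      fmap psi g = comp z (fmap psi v), lifts u v s' x' & x = htens f g + x']
  else x = 0.

Lemma lifts_cat A1 B1 (u : hom A1 A) (v : hom B1 B) s t x :
  lifts u v (s ++ t) x <->
  exists x1 x2, [/\ lifts u v s x1, lifts u v t x2 & x = x1 + x2].
Proof.
elim: s x => [|[y z] s IHs] x /=.
  split=> [tx | [x1 [x2 [-> tx ->]]]]; last by rewrite add0r.
  by exists 0, x; rewrite add0r.
split=> [[f [g [_ [yu zv /IHs[x1 [x2 [sx1 tx2 ->]]] ->]]]] | ].
  by exists (htens f g + x1), x2; rewrite addrA; split=> //; exists f, g, x1.
move=> [_ [x2 [[f [g [x1 [yu zv sx1 ->]]]] tx2 ->]]].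
exists f, g, (x1 + x2); rewrite addrA; split=> //.
by apply/IHs; exists x1, x2.
Qed.

Lemma lifts1 A1 B1 (u : hom A1 A) (v : hom B1 B) y z x :
  lifts u v [:: (y, z)] x <->
  exists f g, [/\ fmap phi f = comp y (fmap phi u),
    fmap psi g = comp z (fmap psi v) & x = htens f g].
Proof.
split=> [[f [g [_ [yu zv -> ->]]]] | [f [g [yu zv ->]]]].
  by exists f, g; rewrite addr0.
by exists f, g, 0; rewrite addr0.
Qed.

Lemma lifts_comp A1 B1 (u : hom A1 A) (v : hom B1 B) A2 B2
    (u' : hom A2 A1) (v' : hom B2 B1) s x :
  lifts u v s x -> lifts (comp u u') (comp v v') s (comp x (htens u' v')).
Proof.
elim: s x => [|[y z] s IHs] x => [->|[f [g [x' [yu zv sx ->]]]]].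
  by rewrite comp0m.
exists (comp f u'), (comp g v'), (comp x' (htens u' v')).
by rewrite !fmap_comp !compA yu zv compDl comp_htens; split=> //; exact: IHs.
Qed.

(** Intersect the sieves that (F) provides for the finitely many terms. *)
Lemma lifts_cover (s : pairs) : exists R S, [/\ Ta A R, Tb B S &
  forall A1 B1 (u : hom A1 A) (v : hom B1 B), R A1 u -> S B1 v ->
    exists x, lifts u v s x].
Proof.
elim: s => [|[y z] s [R [S [TR TS RSs]]]].
  exists (sieve_max A), (sieve_max B); split; try exact: top_max.
  by move=> A1 B1 u v _ _; exists 0.
exists (sieve_meet (lift_sieve (sieve_max A') y) R).
exists (sieve_meet (lift_sieve (sieve_max B') z) S); split.
- by apply: cover_meet => //; apply: (cond_FP _ _).1.
- by apply: cover_meet => //; apply: (cond_FP _ _).1.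
move=> A1 B1 u v [[f _ yu] Ru] [[g _ zv] Sv].
have [x sx] := RSs _ _ _ _ Ru Sv.
by exists (htens f g + x), f, g, x.
Qed.

End LocalLifts.

Section LocalInjectivity.
Hypotheses (Fphi : cond_F Ta phi) (Fpsi : cond_F Tb psi).
Hypotheses (FFphi : cond_FF Ta phi) (FFpsi : cond_FF Tb psi).

Lemma eqloc_htens (A A' : a) (B B' : b) (f f' : hom A A') (g g' : hom B B') :
  fmap phi f = fmap phi f' -> fmap psi g = fmap psi g' ->
  eqloc Tab (htens f g : hom ((A, B) : ab) (A', B')) (htens f' g').
Proof.
move=> ff' gg'.
have Tff' := (cond_FFP _ _).1 FFphi _ _ _ _ ff'.
have Tgg' := (cond_FFP _ _).1 FFpsi _ _ _ _ gg'.
have Tfg := top_boxM Tff' Tgg'.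
apply: (cover_closure Tfg); apply: sieve_box_sub => A2 B2 u v.
rewrite !sieve_pullE !sieve_zeroE !compBl => /subr0_eq fu /subr0_eq gv.
by rewrite closure_diffE !comp_htens fu gv; exact: eqloc_refl.
Qed.

Section Hom.
Variables (A A' : a) (B B' : b).
Local Notation pairs := (seq (hom (phi A) (phi A') * hom (psi B) (psi B'))).

Lemma lifts_unique A1 B1 (u : hom A1 A) (v : hom B1 B) (s : pairs) x x' :
  lifts u v s x -> lifts u v s x' -> eqloc Tab x x'.
Proof.
elim: s x x' => [|[y z] s IHs] x x'; first by move=> -> ->; exact: eqloc_refl.
move=> [f [g [x1 [yu zv sx ->]]]] [f' [g' [x1' [yu' zv' sx' ->]]]].
apply: eqlocD; last exact: IHs sx sx'.
by apply: eqloc_htens; rewrite ?yu ?zv.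
Qed.

(** Local injectivity of [Phi], at the level of formal sums. *)
Lemma lifts_tensor_eq (s t : pairs) : tensor_eq s t ->
  forall A1 B1 (u : hom A1 A) (v : hom B1 B) x x',
    lifts u v s x -> lifts u v t x' -> eqloc Tab x x'.
Proof.
elim=> {s t} [s|s t _ IH|s t r _ IHst _ IHtr|s s' t t' _ IHs _ IHt|s t|z|y y' z
  |y z z'|l y z] A1 B1 u v x x'.
- exact: lifts_unique.
- by move=> tx sx'; apply: eqloc_sym; exact: IH sx' tx.
  (* The middle sum t need not lift along u and v, but it does after a further
     restriction to a covering sieve. *)
- move=> sx rx'; have [R [S [TR TS RSt]]] := lifts_cover Fphi Fpsi t.
  have TRS := top_boxM (top_pull u TR) (top_pull v TS).
  apply: (cover_closure TRS); apply: sieve_box_sub => A2 B2 u' v' Ru Sv.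
  rewrite closure_diffE.
  have [w tw] := RSt _ _ _ _ Ru Sv.
  apply: (eqloc_trans (g := w)).
    by apply: IHst tw; exact: lifts_comp.
  by apply: IHtr tw _; exact: lifts_comp.
- move=> /lifts_cat[x1 [x2 [sx1 tx2 ->]]] /lifts_cat[x1' [x2' [sx1' tx2' ->]]].
  by apply: eqlocD; [exact: IHs sx1 sx1' | exact: IHt tx2 tx2'].
- move=> /lifts_cat[x1 [x2 [sx1 tx2 ->]]] /lifts_cat[x1' [x2' [tx1' sx2' ->]]].
  rewrite [x1' + x2']addrC.
  apply: eqlocD; first exact: lifts_unique sx1 sx2'.
  exact: lifts_unique tx2 tx1'.
- move=> /lifts1[f [g [yu zv ->]]] ->; rewrite -(htens0l _ _ g).
  by apply: eqloc_htens; rewrite // yu comp0m linear0.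
- move=> /lifts1[f [g [yu zv ->]]].
  move=> /(lifts_cat _ _ [:: _])[_ [_ [/lifts1[f1 [g1 [yu1 zv1 ->]]]
    /lifts1[f2 [g2 [yu2 zv2 ->]]] ->]]].
  apply: (eqloc_trans (g := htens (f1 + f2) g)).
    by apply: eqloc_htens; rewrite // yu compDl linearD /= yu1 yu2.
  rewrite -[f1]scale1r htensPl !scale1r.
  by apply: eqlocD; apply: eqloc_htens; rewrite // zv ?zv1 ?zv2.
- move=> /lifts1[f [g [yu zv ->]]].
  move=> /(lifts_cat _ _ [:: _])[_ [_ [/lifts1[f1 [g1 [yu1 zv1 ->]]]
    /lifts1[f2 [g2 [yu2 zv2 ->]]] ->]]].
  apply: (eqloc_trans (g := htens f (g1 + g2))).
    by apply: eqloc_htens; rewrite // zv compDl linearD /= zv1 zv2.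
  rewrite -[g1]scale1r htensPr !scale1r.
  by apply: eqlocD; apply: eqloc_htens; rewrite // yu ?yu1 ?yu2.
- move=> /lifts1[f [g [yu zv ->]]] /lifts1[f1 [g1 [yu1 zv1 ->]]].
  apply: (eqloc_trans (g := htens (l *: f1) g)).
    by apply: eqloc_htens; rewrite // yu linearZ /= yu1 compZl.
  have -> : htens (l *: f1) g = htens f1 (l *: g).
    have := htensPr l f1 g 0; have := htensPl l f1 0 g.
    by rewrite !htens0l !htens0r !addr0 => -> ->.
  by apply: eqloc_htens; rewrite // linearZ /= zv zv1 compZl.
Qed.

(** The starting point of the comparison: a morphism of [ab] lifts its own
    image along the identities. *)
Lemma lifts_tens_sum (s : seq (hom A A' * hom B B')) :
  lifts (idm A) (idm B) [seq (fmap phi p.1, fmap psi p.2) | p <- s]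
    (\sum_(p <- s) htens p.1 p.2).
Proof.
elim: s => [|[f g] s IHs]; first by rewrite big_nil.
rewrite big_cons; exists f, g, (\sum_(p <- s) htens p.1 p.2).
by rewrite !fmap_id !compm1.
Qed.

End Hom.

Lemma tensor_FF : cond_FF Tab Phi.
Proof.
apply/cond_FFP => -[A B] [A' B'] x x' xx'.
rewrite (tens_repr x) (tens_repr x') in xx' *.
apply: lifts_tensor_eq (lifts_tens_sum _) (lifts_tens_sum _).
apply/tpiP; rewrite !tpi_sum !big_map.
have fmap_sum (s : seq (hom A A' * hom B B')) :
    \sum_(p <- s) tens (fmap phi p.1) (fmap psi p.2) =
    fmap Phi (\sum_(p <- s) htens p.1 p.2 : hom ((A, B) : ab) (A', B')).
  by rewrite linear_sum; apply: eq_bigr => p _; rewrite fmap_htens.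
by rewrite !fmap_sum.
Qed.

End LocalInjectivity.

Section CoverTransfer.
Variables (Tc : lintop c) (Td : lintop d).
Local Notation Tcd := (top_box Tc Td).
Hypotheses (LCphi : cond_LC Ta Tc phi) (LCpsi : cond_LC Tb Td psi).

Lemma image_box_sub (A : a) (B : b) (R : sieve A) (S : sieve B) :
  sub_sieve (sieve_box (sieve_image phi R) (sieve_image psi S))
    (sieve_image Phi (sieve_box R S)).
Proof.
apply: (sieve_box_gen_sub (X := sieve_image Phi (sieve_box R S))).
move=> [A1 [r Rr]] [B1 [s Ss]].
have Prs : sieve_image Phi (sieve_box R S) _ (fmap Phi (htens r s)).
  by apply: sieve_image_mem; exact: sieve_box_mem.
by rewrite fmap_htens in Prs.
Qed.

(** The sieves in [top_image] form a topology that contains the generating boxes: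
    a pullback of such a box contains some R' box S', whose image contains the
    box of the images of R' and S'. *)
Lemma tensor_image_cover (P : ab) (R : sieve P) :
  Tab P R -> Tcd (Phi P) (sieve_image Phi R).
Proof.
have [_ _ _ Iphi] := LCphi; have [_ _ _ Ipsi] := LCpsi.
have box_cover (A : a) (B : b) (R1 : sieve A) (S : sieve B) :
    Ta A R1 -> Tb B S -> top_image Phi Tcd (A, B) (sieve_box R1 S).
  move=> TR TS [A' B'] h.
  have [R' [S' [/Iphi TR' /Ipsi TS' sub]]] := top_box_pull h TR TS.
  have TRS := top_boxM TR' TS'; apply: cover_sub TRS => Q u /image_box_sub.
  by apply: sieve_image_sub => P1 f /sub; exact: sieve_image_mem.
move=> TR; have : top_image Phi Tcd P R.
  apply: top_box_min TR => A B S TS; apply: box_cover => //; exact: top_max.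
by move=> /(_ P (idm P)); rewrite sieve_pull1.
Qed.

(** Likewise for [top_preim], where the inverse image of R' box S' contains the
    box of the inverse images of R' and S'. *)
Lemma tensor_preim_cover (P : ab) (S : sieve (Phi P)) :
  Tcd (Phi P) S -> Tab P (sieve_preim S).
Proof.
have box_cover (C : c) (D : d) (R : sieve C) (S1 : sieve D) :
    Tc C R -> Td D S1 -> top_preim Phi Tab (C, D) (sieve_box R S1).
  move=> TR TS [A B] h.
  have [R' [S' [TR' TS' sub]]] :=
    top_box_pull (h : hom ((phi A, psi B) : cd) (C, D)) TR TS.
  have TRS := top_boxM (cover_preim LCphi TR') (cover_preim LCpsi TS').
  apply: cover_sub TRS; apply: sieve_box_sub => A1 B1 u v Ru Sv.
  have Ruv : sieve_box R' S' _ (htens (fmap phi u) (fmap psi v)).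
    exact: sieve_box_mem.
  by rewrite -fmap_htens in Ruv; exact: sub Ruv.
move=> TS; have : top_preim Phi Tab (Phi P) S.
  apply: top_box_min TS => C D S1 TS1; apply: box_cover => //;
    exact: top_max.
by move=> /(_ P (idm _)); rewrite sieve_pull1.
Qed.

Lemma tensor_LC : cond_LC Tab Tcd Phi.
Proof.
have [Gphi Fphi FFphi _] := LCphi; have [Gpsi Fpsi FFpsi _] := LCpsi.
split; [exact: tensor_G | exact: tensor_F | exact: tensor_FF | ].
move=> P R; split=> [|TR]; first exact: tensor_image_cover.
apply: (cover_preim_image (phi := Phi)); first exact: tensor_F.
  exact: tensor_FF.
exact: tensor_preim_cover.
Qed.

End CoverTransfer.
End TensorFunctor.

Theorem proposition3p14 (k : comPzRingType) (a b c d : lincat k)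
  (Ta : lintop a) (Tb : lintop b) (Tc : lintop c) (Td : lintop d)
  (phi : linfunctor a c) (psi : linfunctor b d) :
  (cond_G Tc phi -> cond_G Td psi ->
     cond_G (top_box Tc Td) (tensor_functor phi psi)) /\
  (cond_F Ta phi -> cond_F Tb psi ->
     cond_F (top_box Ta Tb) (tensor_functor phi psi)) /\
  (cond_F Ta phi /\ cond_FF Ta phi -> cond_F Tb psi /\ cond_FF Tb psi ->
     cond_F (top_box Ta Tb) (tensor_functor phi psi) /\
     cond_FF (top_box Ta Tb) (tensor_functor phi psi)) /\
  (cond_LC Ta Tc phi -> cond_LC Tb Td psi ->
     cond_LC (top_box Ta Tb) (top_box Tc Td) (tensor_functor phi psi)).
Proof.
split; first exact: tensor_G.
split; first exact: tensor_F.
split; last exact: tensor_LC.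
move=> [Fphi FFphi] [Fpsi FFpsi]; split; first exact: tensor_F.
exact: tensor_FF.
Qed.
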